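(* Let $G$ be a $2$-homogeneous permutation group on the set $\{1,\ldots,n\}$. Then the number of $G$-orbits on the set of partitions of $\{1,\ldots,n\}$ of shape $(3,1,\ldots,1)$ is $O(n)$, and the number of $G$-orbits on the set of partitions of shape $(2,2,1,\ldots,1)$ is $O(n^2)$.
   Context: A permutation group on $\{1,\ldots,n\}$ is $2$-homogeneous if it has only one orbit on $2$-subsets. The shape (type) of a set partition is the non-increasing sequence of its part sizes. The constants implied by the $O$-notation are absolute (independent of $n$ and $G$). *)

(* Defs.v *)
From mathcomp Require Import all_boot all_fingroup.

Set Implicit Arguments.
Unset Strict Implicit.
Unset Printing Implicit Defensive.

(* The points {1, ..., n} are represented by 'I_n = {0, ..., n-1}. *)

Definition two_subsets (n : nat) : {set {set 'I_n}} :=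
  [set A : {set 'I_n} | #|A| == 2].

(* 'P^* is the setwise action of permutations on subsets. *)
Definition two_homogeneous (n : nat) (G : {group 'S_n}) : Prop :=
  #|orbit ('P^*)%act G @: two_subsets n| = 1.

Definition partition_shape (n : nat) (P : {set {set 'I_n}}) : seq nat :=
  sort geq [seq #|B| | B : {set 'I_n} in P].

Definition partitions_of_shape (n : nat) (s : seq nat) : {set {set {set 'I_n}}} :=
  [set P : {set {set 'I_n}} | partition P [set: 'I_n] & partition_shape P == s].

(* 'P^*^* maps a set partition P to {g(B) | B in P}. *)
Definition nb_orbits_shape (n : nat) (G : {group 'S_n}) (s : seq nat) : nat :=
  #|orbit ('P^*^*)%act G @: partitions_of_shape n s|.

(* When n < 3 (resp. n < 4) the truncated subtraction yields a sequence whose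
   sum is not n, so that no partition of 'I_n has this shape. *)
Definition shape_3 (n : nat) : seq nat := 3 :: nseq (n - 3) 1.

Definition shape_22 (n : nat) : seq nat := [:: 2, 2 & nseq (n - 4) 1].

(* Main.v *)
Require Import Defs.
From mathcomp Require Import all_boot all_fingroup.

(** The part of a set partition that matters for its orbit is the collection of
    its blocks of size other than 1, since the remaining blocks are singletons
    and can be restored from it ([partition_completion]); restoring the
    singletons commutes with permutations ([completion_act]).

    Fix one 2-subset [A0]. A partition of shape (3,1,...,1) has a single
    nontrivial block, and 2-homogeneity moves two of its three points onto [A0].
    So every orbit meets the set of completions of [A0] plus one point, and
    there are at most [n] of these. A partition of shape (2,2,1,...,1) has two
    nontrivial blocks; moving one of them onto [A0] leaves only the two points
    of the other to be chosen, which gives at most [n ^ 2] orbits. In both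
    cases the constant is 1. *)

Set Implicit Arguments.
Unset Strict Implicit.
Unset Printing Implicit Defensive.

(** An orbit is determined by any normal form it contains, so [T], which indexes
    the normal forms, indexes all the orbits as well. *)
Lemma leq_card_orbits (aT : finGroupType) (rT : finType)
    (to : {action aT &-> rT}) (G : {group aT}) (X : {set rT})
    (T : finType) (f : T -> rT) :
  (forall x, x \in X -> exists2 g, g \in G & exists t, to x g = f t) ->
  #|orbit to G @: X| <= #|T|.
Proof.
move=> normal_form; rewrite -cardsT.
apply: leq_trans (leq_imset_card (fun t => orbit to G (f t)) [set: T]).
apply/subset_leq_card/subsetP => _ /imsetP[x Xx ->].
have [g Gg [t xg_t]] := normal_form x Xx.
by apply/imsetP; exists t; rewrite // -xg_t orbit_act.
Qed.

Lemma set_actionE (aT : finGroupType) (D : {set aT}) (rT : finType)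
    (to : action D rT) (S : {set rT}) (a : aT) :
  (to^*)%act S a = [set to x a | x in S].
Proof. by []. Qed.

(** Having exactly one orbit says two things: some 2-subset exists, which gives
    the base point [A0], and every 2-subset can be moved onto it. *)
Lemma two_homogeneous_trans (n : nat) (G : {group 'S_n}) :
  two_homogeneous G ->
  exists A0 : {set 'I_n},
    forall B : {set 'I_n}, #|B| = 2 ->
      exists2 g, g \in G & ('P^*)%act B g = A0.
Proof.
move/eqP/cards1P => [O orbits_eq].
have orbitE (B : {set 'I_n}) : #|B| = 2 -> orbit ('P^*)%act G B = O.
  move=> cardB; apply/set1P; rewrite -orbits_eq.
  by apply: imset_f; rewrite inE cardB.
have : O \in orbit ('P^*)%act G @: two_subsets n by rewrite orbits_eq set11.
case/imsetP=> A0; rewrite inE => /eqP cardA0 _; exists A0 => // B cardB.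
have : A0 \in orbit ('P^*)%act G B.
  by rewrite (orbitE B) // -(orbitE A0) // orbit_refl.
by case/orbitP=> g Gg <-; exists g.
Qed.

Section Completion.

Variable n : nat.
Implicit Types (P Q : {set {set 'I_n}}) (s : seq nat).

Definition nontrivial_blocks P := [set B in P | #|B| != 1].

Definition completion Q := Q :|: [set [set x] | x in ~: cover Q].

(** A point lies outside all nontrivial blocks exactly when its own block is the
    singleton, because blocks are disjoint and cover everything. *)
Lemma partition_completion P :
  partition P [set: 'I_n] -> P = completion (nontrivial_blocks P).
Proof.
move=> partP; have tiP := partition_trivIset partP.
have covP x : x \in cover P by rewrite (cover_partition partP) inE.
apply/setP=> B; rewrite !inE; apply/idP/idP => [PB|].
  have [/cards1P[x defB]|] := boolP (#|B| == 1); last by rewrite PB.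
  apply/orP; right; apply/imsetP; exists x => //; rewrite inE.
  apply/negP=> /bigcupP[C]; rewrite inE => /andP[PC] ntC Cx.
  have BC : B = C.
    by rewrite -(def_pblock tiP PC Cx) (def_pblock tiP PB) // defB set11.
  by rewrite -BC defB cards1 in ntC.
case/orP=> [/andP[] //|/imsetP[x]]; rewrite inE => trivx ->.
have [C PC Cx] := bigcupP (covP x).
have [/cards1P[y defC]|ntC] := boolP (#|C| == 1).
  by move: Cx PC; rewrite defC => /set1P <-.
by case/bigcupP: trivx; exists C; rewrite // inE PC.
Qed.

(** Thanks to this equivariance, moving a partition amounts to moving its
    nontrivial blocks, which are the only blocks that need to be normalised. *)
Lemma completion_act Q (g : 'S_n) :
  ('P^*^*)%act (completion Q) g = completion (('P^*^*)%act Q g).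
Proof.
rewrite /completion !set_actionE imsetU; congr (_ :|: _).
have -> : ~: cover [set ('P^*)%act B g | B in Q] = g @: ~: cover Q.
  have -> : [set ('P^*)%act B g | B in Q] = [set g @: B | B : {set 'I_n} in Q].
    exact: eq_imset.
  by rewrite cover_imset -imset_cover -(invgK g) !im_permV preimsetC.
rewrite -!imset_comp; apply: eq_imset => x /=.
by rewrite set_actionE imset_set1.
Qed.

(** Discarding the ones turns an equation between lists of length depending on
    [n] into one that involves a short explicit list, from which the nontrivial blocks
    can be read off. *)
Lemma nontrivial_blocks_shape P s :
  partition_shape P = s ->
  perm_eq [seq #|B| | B : {set 'I_n} <- enum (nontrivial_blocks P)]
          [seq k <- s | k != 1].
Proof.
move=> <-; rewrite /partition_shape.
have /permPr-> := perm_filter (fun k => k != 1)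
                    (permEl (perm_sort geq [seq #|B| | B : {set 'I_n} in P])).
rewrite /image_mem filter_map; apply: perm_map.
apply: uniq_perm => [||B]; rewrite ?enum_uniq //.
  by apply: filter_uniq; apply: enum_uniq.
by rewrite mem_enum inE mem_filter mem_enum andbC.
Qed.

Lemma shape_3P P :
  P \in partitions_of_shape n (shape_3 n) ->
  exists2 B : {set 'I_n}, #|B| = 3 & P = completion [set B].
Proof.
rewrite inE => /andP[/partition_completion defP /eqP/nontrivial_blocks_shape].
have -> : [seq k <- shape_3 n | k != 1] = [:: 3].
  by rewrite /= filter_nseq.
move/(perm_small_eq (s2 := [:: 3]) isT).
case enumP: (enum _) => [|B []] // [cardB].
exists B => //; rewrite defP; congr completion.
by apply/setP=> C; rewrite -mem_enum enumP !inE.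
Qed.

Lemma shape_22P P :
  P \in partitions_of_shape n (shape_22 n) ->
  exists B1 B2 : {set 'I_n},
    [/\ #|B1| = 2, #|B2| = 2 & P = completion [set B1; B2]].
Proof.
rewrite inE => /andP[/partition_completion defP /eqP/nontrivial_blocks_shape].
have -> : [seq k <- shape_22 n | k != 1] = nseq 2 2.
  by rewrite /= filter_nseq.
move=> sizes; have := perm_size sizes; have := perm_mem sizes.
case enumP: (enum _) => [|B1 [|B2 []]] //= mem_sizes _.
have card2 B : B \in [:: B1; B2] -> #|B| = 2.
  move=> /(map_f (fun A : {set 'I_n} => #|A|)) /=.
  by rewrite mem_sizes !inE orbb => /eqP.
exists B1, B2; split; try by rewrite card2 // !inE eqxx ?orbT.
rewrite defP; congr completion.
by apply/setP=> C; rewrite -mem_enum enumP !inE.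
Qed.

End Completion.

Lemma nb_orbits_shape_3 (n : nat) (G : {group 'S_n}) :
  two_homogeneous G -> nb_orbits_shape G (shape_3 n) <= n.
Proof.
move=> /two_homogeneous_trans[A0 to_A0]; rewrite -[leqRHS]card_ord.
apply: (leq_card_orbits (f := fun c => completion [set c |: A0])) => P.
case/shape_3P=> B cardB ->.
have [x Bx] : exists x, x \in B by apply/card_gt0P; rewrite cardB.
(* The pair to be moved onto [A0] is the block with one point [x] removed; the
   image of [x] is then the only free parameter. *)
have cardBx : #|B :\ x| = 2.
  by move: cardB; rewrite (cardsD1 x) Bx; case.
have [g Gg gA0] := to_A0 _ cardBx; exists g => //; exists (g x).
rewrite completion_act set_actionE imset_set1 -{1}(setD1K Bx) -gA0.
by rewrite !set_actionE imsetU1.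
Qed.

Lemma nb_orbits_shape_22 (n : nat) (G : {group 'S_n}) :
  two_homogeneous G -> nb_orbits_shape G (shape_22 n) <= n ^ 2.
Proof.
move=> /two_homogeneous_trans[A0 to_A0].
have <- : #|{: 'I_n * 'I_n}| = n ^ 2 by rewrite card_prod card_ord mulnn.
pose f (cd : 'I_n * 'I_n) := completion [set A0; [set cd.1; cd.2]].
apply: (leq_card_orbits (f := f)) => P.
case/shape_22P=> B1 [B2 [cardB1 cardB2 ->]].
have [g Gg gA0] := to_A0 _ cardB1; exists g => //.
have /cards2P[c [d [_ gB2]]] : #|('P^*)%act B2 g| == 2.
  by rewrite (card_setact 'P%act) cardB2.
exists (c, d).
by rewrite completion_act set_actionE imsetU1 imset_set1 gA0 gB2.
Qed.

Theorem theorem2p7 :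
  (exists C : nat, forall (n : nat) (G : {group 'S_n}),
      two_homogeneous G -> nb_orbits_shape G (shape_3 n) <= C * n) /\
  (exists C : nat, forall (n : nat) (G : {group 'S_n}),
      two_homogeneous G -> nb_orbits_shape G (shape_22 n) <= C * n ^ 2).
Proof.
split; exists 1 => n G homG; rewrite mul1n.
  exact: nb_orbits_shape_3.
exact: nb_orbits_shape_22.
Qed.
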